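(* Let $m,n\in\frac1T\mathbb N$. Then $*^T_{m,m,m}$ induces a well-defined product on $A^T_m(V)$ making it an associative $\mathbb C$-algebra with identity the class of $\mathbf 1$, and $A^T_{n,m}(V)$ is an $A^T_n(V)$-$A^T_m(V)$-bimodule, where the left action of $A^T_n(V)$ is induced by $*^T_{n,n,m}$ and the right action of $A^T_m(V)$ is induced by $*^T_{n,m,m}$.
   Context: Throughout, $T$ is a positive integer and $V$ is a vertex algebra (vertex operator $Y(a,x)=\sum_{i\in\mathbb Z}a_ix^{-i-1}$, vacuum $\mathbf 1$) with a grading $V=\bigoplus_{i\ge\Delta}V_i$, $\Delta\in\mathbb Z_{\le0}$, such that $\mathbf 1\in V_0$ and $a_iV_j\subset V_{\mathrm{wt}a-1-i+j}$ for homogeneous $a$ ($\mathrm{wt}\,a=k$ for $a\in V_k$; $V_k=0$ for $k<\Delta$). $\mathbb N=\{0,1,2,\dots\}$. For rationals $i,j$, $\delta(i\le j)$ is $1$ if $i\le j$ and $0$ otherwise. For $i,j\in\frac1T\mathbb Z$, $\langle i-j\rangle$ is the unique integer $r$ with $0\le r\le T-1$ and $i-j-r/T\in\mathbb Z$. $\mathrm{Res}_x$ is the coefficient of $x^{-1}$; $(1+x)^c$ ($c\in\mathbb Q$) is $\sum_{k\ge0}\binom ckx^k$. For $f(z)=\sum_j\lambda_jz^j\in\mathbb C[z,z^{-1}]$ and $a,b\in V$, $f(z)|_{z^j=a_jb}=\sum_j\lambda_ja_jb$. Polynomial subspaces: for $N,q\in\mathbb Z$, $Q\in\mathbb Q$,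 $O(N,Q,q;z)\subset\mathbb C[z,z^{-1}]$ is spanned by $z^i$ ($i\ge N+1$) and $\sum_{i=0}^{N-q-j}\binom Qiz^{i+q+j}$ ($j=0,-1,-2,\dots$). For $m=l_1+i_1/T$, $n=l_3+i_3/T\in\frac1T\mathbb N$ ($l_1,l_3\in\mathbb N$, $0\le i_1,i_3\le T-1$), $\alpha,\beta\in\mathbb Z$, $s\in\{0,\dots,T-1\}$: $\mathcal O^{T,s}_{n,m}(\alpha,\beta;z)=O(\alpha+\beta-1-\Delta,\ \alpha-1+l_1+\delta(s\le i_1)+s/T,\ -l_1-l_3-\delta(s\le i_1)-\delta(T\le s+i_3)-1;z)$, and $\mathcal O^T_{n,m}(\alpha,\beta;z)=\bigcap_s\mathcal O^{T,s}_{n,m}(\alpha,\beta;z)$. Idempotent polynomials: put $N=\alpha+\beta-1-\Delta$ and $D=N+l_1+l_3+3$. For $r\in\{0,\dots,T-1\}$ and $i\in\mathbb Z$, $e^{T,r}_{n,m}(\alpha,\beta,i;z)=0$ if $i\ge N+1$ or $D\le0$; otherwise it is the unique Laurent polynomial in $\mathrm{span}\{z^k:N+1-TD\le k\le N\}$ with $e^{T,r}_{n,m}(\alpha,\beta,i;z)\equiv\delta_{r,s}z^i$ modulo $O(N,\alpha-1+l_1+\delta(s\le i_1)+s/T,-l_1-l_3-3;z)$ for every $s\in\{0,\dots,T-1\}$. Product: for $p=l_2+i_2/T\in\frac1T\mathbb N$ ($l_2\in\mathbb N$, $0\le i_2\le T-1$), let $r=\langle p-n\rangle$, $\mu=l_2-l_1-l_3-\delta(r\le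 i_1)-\delta(T\le r+i_3)$, and $P^T_{n,p,m}(\alpha,\beta;z)=\sum_{i=0}^{l_2}\binom{\mu}{i}\mathrm{Res}_x\Big((1+x)^{\alpha-1+l_1+\delta(r\le i_1)+r/T}x^{\mu-i}\sum_{j\in\mathbb Z}e^{T,r}_{n,m}(\alpha,\beta,j;z)x^{-j-1}\Big)$. For homogeneous $a,b\in V$, $a*^T_{n,p,m}b=P^T_{n,p,m}(\mathrm{wt}\,a,\mathrm{wt}\,b;z)|_{z^j=a_jb}$, extended bilinearly. Subspaces of $V$: $O^T_{0,n,m}(V)$ is spanned by $a_{-2}\mathbf 1+(\mathrm{wt}\,a+m-n)a$ ($a$ homogeneous); $O^T_{1,n,m}(V)$ is spanned by $f(z)|_{z^j=a_jb}$ for homogeneous $a,b$ and $f\in\mathcal O^T_{n,m}(\mathrm{wt}\,a,\mathrm{wt}\,b;z)$; $O^T_{2,n,m}(V)$ is spanned by $u*^T_{n,p_3,m}\big((a*^T_{p_3,p_2,p_1}b)*^T_{p_3,p_1,m}c-a*^T_{p_3,p_2,m}(b*^T_{p_2,p_1,m}c)\big)$ for $a,b,c,u\in V$, $p_1,p_2,p_3\in\frac1T\mathbb N$; $O^T_{3,n,m}(V)$ is spanned by $(u*^T_{n,p_2,p_1}y)*^T_{n,p_1,m}c$ for $u,c\in V$, $p_1,p_2\in\frac1T\mathbb N$, $y\in O^T_{0,p_2,p_1}(V)+O^T_{1,p_2,p_1}(V)$. $O^T_{n,m}(V)=\sum_{k=0}^3O^T_{k,n,m}(V)$, $A^T_{n,m}(V)=V/O^T_{n,m}(V)$,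 and $A^T_m(V)=A^T_{m,m}(V)$. *)

(* Defs.v *)
From HB Require Import structures.
From mathcomp Require Import all_boot all_order all_algebra.
From Stdlib Require ClassicalEpsilon List.

Set Implicit Arguments.
Unset Strict Implicit.
Unset Printing Implicit Defensive.

Import Order.TTheory GRing.Theory Num.Theory.
Local Open Scope ring_scope.

Definition int_to_nat (x : int) : nat :=
  match x with Posz n => n | Negz _ => 0%N end.

Definition dle (i j : nat) : nat := if (i <= j)%N then 1%N else 0%N.

Definition qbin (Q : rat) (i : nat) : rat :=
  (\prod_(k < i) (Q - k%:R)) / (i`!)%:R.

(*   gpr k        =  projection V -> V_k of the grading               *)
(*   gsupp v      =  a finite list of weights containing the support  *)

Section VADef.
Variables (K : fieldType) (V : lmodType K).

Record VA := {
  va_nprod : int -> V -> V -> V;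
  va_vac : V;
  va_Delta : int;
  va_gpr : int -> V -> V;
  va_gsupp : V -> seq int;
  va_nprod_linl : forall i (k : K) a a' b,
    va_nprod i (k *: a + a') b = k *: va_nprod i a b + va_nprod i a' b;
  va_nprod_linr : forall i (k : K) a b b',
    va_nprod i a (k *: b + b') = k *: va_nprod i a b + va_nprod i a b';
  va_trunc : forall a b, exists N : int, forall i, N <= i -> va_nprod i a b = 0;
  va_vac_left : forall i b, va_nprod i va_vac b = if i == -1 then b else 0;
  va_vac_right_pos : forall i a, 0 <= i -> va_nprod i a va_vac = 0;
  va_vac_right_m1 : forall a, va_nprod (-1) a va_vac = a;
  (* Borcherds (Jacobi) identity; the sums are finite by truncation,
     so we require equality of all sufficiently long partial sums *)
  va_borcherds : forall (a b c : V) (p q r : int), exists M0 : nat,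
    forall M : nat, (M0 <= M)%N ->
      \sum_(i < M) ratr (qbin p%:~R i) *:
          va_nprod (p + q - i%:Z) (va_nprod (r + i%:Z) a b) c
    = \sum_(i < M) ((-1) ^+ i * ratr (qbin r%:~R i)) *:
          (va_nprod (p + r - i%:Z) a (va_nprod (q + i%:Z) b c)
           - (-1) ^+ `|r|%N *: va_nprod (q + r - i%:Z) b (va_nprod (p + i%:Z) a c));
  va_gpr_lin : forall k (c : K) u v, va_gpr k (c *: u + v) = c *: va_gpr k u + va_gpr k v;
  va_gpr_orth : forall k l v, va_gpr k (va_gpr l v) = if k == l then va_gpr l v else 0;
  va_gsupp_sum : forall v, v = \sum_(k <- va_gsupp v) va_gpr k v;
  va_gsupp_out : forall k v, k \notin va_gsupp v -> va_gpr k v = 0;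
  va_Delta_le0 : va_Delta <= 0;
  va_gpr_below : forall k v, k < va_Delta -> va_gpr k v = 0;
  va_vac_wt0 : va_gpr 0 va_vac = va_vac;
  va_nprod_wt : forall k j i a b,
    va_gpr (k - 1 - i + j) (va_nprod i (va_gpr k a) (va_gpr j b))
    = va_nprod i (va_gpr k a) (va_gpr j b)
}.

Definition vspan (S : V -> Prop) (v : V) : Prop :=
  exists l : seq (K * V), (forall x, List.In x l -> S x.2) /\
    v = \sum_(x <- l) x.1 *: x.2.

End VADef.

(* Laurent polynomials in z are coefficient functions int -> K;
   span is pointwise finite linear combination *)
Definition fspan (K : fieldType) (S : (int -> K) -> Prop) (f : int -> K) : Prop :=
  exists l : seq (K * (int -> K)), (forall x, List.In x l -> S x.2) /\
    forall k, f k = \sum_(x <- l) x.1 * x.2 k.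

Definition lcoef (K : fieldType) (l : seq (int * K)) (k : int) : K :=
  \sum_(x <- l) (if x.1 == k then x.2 else 0).

Definition Ogen (K : fieldType) (N : int) (Q : rat) (q : int) (f : int -> K) : Prop :=
  (exists i : int, N + 1 <= i /\ forall k, f k = if k == i then 1 else 0)
  \/ (exists t : nat, (* j = -t *)
        forall k, f k = \sum_(i < int_to_nat (N - q + t%:Z + 1))
                          (if k == i%:Z + q - t%:Z then ratr (qbin Q i) else 0)).

Definition Omem (K : fieldType) (N : int) (Q : rat) (q : int) (f : int -> K) : Prop :=
  fspan (Ogen N Q q) f.

Section Zhu.
Variables (K : fieldType) (V : lmodType K) (A : VA V) (T : nat).

Local Notation nprod := (va_nprod A).
Local Notation vac := (va_vac A).
Local Notation Delta := (va_Delta A).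
Local Notation gpr := (va_gpr A).
Local Notation gsupp := (va_gsupp A).

Definition homog (k : int) (a : V) : Prop := gpr k a = a.

(* an element x = xx/T of (1/T)N is represented by its numerator xx;
   x = ld xx + lr xx / T *)
Definition ld (xx : nat) : nat := (xx %/ T)%N.
Definition lr (xx : nat) : nat := (xx %% T)%N.

Definition angle (nn pp : nat) : nat := int_to_nat ((pp%:Z - nn%:Z) %% T%:Z)%Z.

Definition Qval (alpha : int) (l d s : nat) : rat :=
  (alpha - 1 + l%:Z + d%:Z)%:~R + s%:R / T%:R.

Definition calO_s (nn mm : nat) (alpha beta : int) (s : nat) (f : int -> K) : Prop :=
  Omem (alpha + beta - 1 - Delta) (Qval alpha (ld mm) (dle s (lr mm)) s)
       (- (ld mm)%:Z - (ld nn)%:Z - (dle s (lr mm))%:Z - (dle T (s + lr nn))%:Z - 1) f.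

Definition calO (nn mm : nat) (alpha beta : int) (f : int -> K) : Prop :=
  forall s, (s < T)%N -> calO_s nn mm alpha beta s f.

Definition Nv (alpha beta : int) : int := alpha + beta - 1 - Delta.
Definition Dv (nn mm : nat) (alpha beta : int) : int :=
  Nv alpha beta + (ld mm)%:Z + (ld nn)%:Z + 3.

Definition is_idem (nn mm : nat) (alpha beta : int) (r : nat) (i : int) (e : int -> K) : Prop :=
  (forall k, k < Nv alpha beta + 1 - T%:Z * Dv nn mm alpha beta \/ Nv alpha beta < k ->
             e k = 0) /\
  forall s, (s < T)%N ->
    Omem (Nv alpha beta) (Qval alpha (ld mm) (dle s (lr mm)) s)
         (- (ld mm)%:Z - (ld nn)%:Z - 3)
         (fun k => e k - (if (r == s) && (k == i) then 1 else 0)).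

Definition idem (nn mm : nat) (alpha beta : int) (r : nat) (i : int) : int -> K :=
  if (Nv alpha beta + 1 <= i) || (Dv nn mm alpha beta <= 0) then (fun _ => 0)
  else ClassicalEpsilon.epsilon (inhabits (fun _ => 0)) (is_idem nn mm alpha beta r i).

(* P^T_{n,p,m}(alpha,beta;z), with Res_x computed explicitly:
   Res_x((1+x)^c x^(mu-i) sum_j e_j x^(-j-1)) = sum_{k>=0} binom(c,k) e_{k+mu-i},
   the terms with k+mu-i >= N+1 vanishing *)
Definition Ppoly (nn pp mm : nat) (alpha beta : int) (k : int) : K :=
  let r := angle nn pp in
  let c := Qval alpha (ld mm) (dle r (lr mm)) r in
  let mu : int := (ld pp)%:Z - (ld mm)%:Z - (ld nn)%:Z
                  - (dle r (lr mm))%:Z - (dle T (r + lr nn))%:Z in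
  \sum_(i < (ld pp).+1)
     ratr (qbin mu%:~R i) *
     \sum_(j < int_to_nat (Nv alpha beta - mu + i%:Z + 1))
        ratr (qbin c j) * idem nn mm alpha beta r (j%:Z + mu - i%:Z) k.

(* a *^T_{n,p,m} b for a in V_alpha, b in V_beta: substitute z^k = a_k b;
   P is supported in [N+1-TD, N] *)
Definition homstar (nn pp mm : nat) (alpha beta : int) (a b : V) : V :=
  \sum_(t < int_to_nat (T%:Z * Dv nn mm alpha beta))
     Ppoly nn pp mm alpha beta (Nv alpha beta + 1 - T%:Z * Dv nn mm alpha beta + t%:Z) *:
     nprod (Nv alpha beta + 1 - T%:Z * Dv nn mm alpha beta + t%:Z) a b.

Definition star (nn pp mm : nat) (a b : V) : V :=
  \sum_(alpha <- gsupp a) \sum_(beta <- gsupp b)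
     homstar nn pp mm alpha beta (gpr alpha a) (gpr beta b).

Definition O0gen (nn mm : nat) (v : V) : Prop :=
  exists (k : int) (a : V), homog k a /\
    v = nprod (-2) a vac + ratr (k%:~R + (mm%:R - nn%:R) / T%:R) *: a.

Definition O1gen (nn mm : nat) (v : V) : Prop :=
  exists (alpha beta : int) (a b : V) (l : seq (int * K)),
    homog alpha a /\ homog beta b /\ calO nn mm alpha beta (lcoef l) /\
    v = \sum_(x <- l) x.2 *: nprod x.1 a b.

Definition O2gen (nn mm : nat) (v : V) : Prop :=
  exists (a b c u : V) (p1 p2 p3 : nat),
    v = star nn p3 mm u
          (star p3 p1 mm (star p3 p2 p1 a b) c - star p3 p2 mm a (star p2 p1 mm b c)).

Definition O3gen (nn mm : nat) (v : V) : Prop :=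
  exists (u c y : V) (p1 p2 : nat),
    vspan (fun w => O0gen p2 p1 w \/ O1gen p2 p1 w) y /\
    v = star nn p1 mm (star nn p2 p1 u y) c.

Definition Onm (nn mm : nat) (v : V) : Prop :=
  vspan (fun w => O0gen nn mm w \/ O1gen nn mm w \/ O2gen nn mm w \/ O3gen nn mm w) v.

Definition induces_assoc_algebra (mm : nat) : Prop :=
  let O := Onm mm mm in
  let mul := star mm mm mm in
  (forall a a' b b', O (a - a') -> O (b - b') -> O (mul a b - mul a' b')) /\
  (forall (k : K) a a' b, O (mul (k *: a + a') b - (k *: mul a b + mul a' b))) /\
  (forall (k : K) a b b', O (mul a (k *: b + b') - (k *: mul a b + mul a b'))) /\
  (forall a b c, O (mul (mul a b) c - mul a (mul b c))) /\
  (forall a, O (mul vac a - a) /\ O (mul a vac - a)).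

Definition induces_bimodule (nn mm : nat) : Prop :=
  let On := Onm nn nn in
  let Om := Onm mm mm in
  let O := Onm nn mm in
  let mulN := star nn nn nn in
  let mulM := star mm mm mm in
  let lact := star nn nn mm in
  let ract := star nn mm mm in
  (forall a a' v v', On (a - a') -> O (v - v') -> O (lact a v - lact a' v')) /\
  (forall v v' c c', O (v - v') -> Om (c - c') -> O (ract v c - ract v' c')) /\
  (forall (k : K) a a' v, O (lact (k *: a + a') v - (k *: lact a v + lact a' v))) /\
  (forall (k : K) a v v', O (lact a (k *: v + v') - (k *: lact a v + lact a v'))) /\
  (forall (k : K) v v' c, O (ract (k *: v + v') c - (k *: ract v c + ract v' c))) /\
  (forall (k : K) v c c', O (ract v (k *: c + c') - (k *: ract v c + ract v c'))) /\
  (forall a b v, O (lact (mulN a b) v - lact a (lact b v))) /\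
  (forall v c d, O (ract (ract v c) d - ract v (mulM c d))) /\
  (forall a v c, O (ract (lact a v) c - lact a (ract v c))) /\
  (forall v, O (lact vac v - v) /\ O (ract v vac - v)).

End Zhu.

(* Main.v *)
Require Import Defs.
From HB Require Import structures.
From mathcomp Require Import all_boot all_order all_algebra.
From mathcomp Require Import zify ring lra.
From Stdlib Require ClassicalEpsilon List.

(* The subspaces O_2 and O_3 are built so that associativity modulo O_{n,m} and stability of the
   family O_{n,m} under products on either side are formal consequences of the two unit laws
   1 *_{n,n,m} v = v (an exact equality) and v *_{n,m,m} 1 = v modulo O_{n,m}.

   For the two unit laws, send f(z) to the polynomial F_f(x) = Res_z z^(-N-1) (1+z)^x f(z).
   By Chu-Vandermonde, f lies in O(N,Q,q;z) iff F_f vanishes at x = t - Q for 0 <= t < N - q, so the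
   idempotent polynomials exist by interpolation at distinct nodes, and for f = P_{n,p,m}
   and p = n or p = m the values F_f(x0), ..., F_f(x0 + N + 1) at suitable nodes are 0, ..., 0, 1.
   Their (N+1)-st finite difference is Res_z (1+z)^(x0) f(z), which is the scalar by which the unit acts. *)

Set Implicit Arguments.
Unset Strict Implicit.
Unset Printing Implicit Defensive.

Import Order.TTheory GRing.Theory Num.Theory.
Local Open Scope ring_scope.

(** * Rational scalars and binomial coefficients over a field of characteristic zero *)

Section CharZero.
Variables (K : fieldType) (charK : [pchar K] =i pred0).

Lemma natf_eq0 n : (n%:R == 0 :> K) = (n == 0)%N.
Proof. by have /pcharf0P -> := charK. Qed.

Lemma intf_eq0 (z : int) : (z%:~R == 0 :> K) = (z == 0).
Proof.
case: z => n; first by rewrite -pmulrn natf_eq0.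
by rewrite NegzE mulrNz oppr_eq0 -pmulrn natf_eq0.
Qed.

Lemma natf_inj : injective (fun n : nat => n%:R : K).
Proof.
move=> m n /eqP; wlog le_mn : m n / (m <= n)%N => [IH|].
  case/orP: (leq_total m n) => h e; first exact: IH e.
  by symmetry; apply: IH; rewrite // eq_sym.
by rewrite eq_sym -subr_eq0 -natrB // natf_eq0 subn_eq0 => h; lia.
Qed.

(** [ratr] divides the reduced numerator by the reduced denominator; independence of the chosen
    fraction is what yields additivity and multiplicativity below. *)
Lemma ratr_frac (a b : int) :
  b != 0 -> ratr (a%:~R / b%:~R) = a%:~R / b%:~R :> K.
Proof.
move=> b0; set x := _ / _ : rat.
have bq : b%:~R != 0 :> rat by rewrite intr_eq0.
have e : numq x * b = a * denq x.
  apply/eqP; rewrite -(eqr_int rat) !rmorphM /= numqE.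
  by rewrite /x mulrAC divfK.
rewrite /ratr; apply/eqP; rewrite eqr_div ?intf_eq0 ?denq_neq0 //.
by rewrite -!rmorphM /= e.
Qed.

Lemma ratrD (x y : rat) : ratr (x + y) = ratr x + ratr y :> K.
Proof.
have h : x + y = (numq x * denq y + numq y * denq x)%:~R
                 / (denq x * denq y)%:~R.
  rewrite -{1}(divq_num_den x) -{1}(divq_num_den y) addf_div ?intr_eq0 ?denq_neq0 //.
  by rewrite !(rmorphD, rmorphM).
rewrite {1}h ratr_frac ?mulf_neq0 ?denq_neq0 // /ratr.
by rewrite addf_div ?intf_eq0 ?denq_neq0 // !(rmorphD, rmorphM).
Qed.

Lemma ratrM (x y : rat) : ratr (x * y) = ratr x * ratr y :> K.
Proof.
have h : x * y = (numq x * numq y)%:~R / (denq x * denq y)%:~R.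
  by rewrite -{1}(divq_num_den x) -{1}(divq_num_den y) mulf_div !rmorphM.
rewrite {1}h ratr_frac ?mulf_neq0 ?denq_neq0 // /ratr.
by rewrite mulf_div !rmorphM.
Qed.

Lemma ratr_natf n : ratr n%:R = n%:R :> K.
Proof. by rewrite ratr_nat. Qed.

Lemma ratrN (x : rat) : ratr (- x) = - ratr x :> K.
Proof.
by apply/eqP; rewrite -subr_eq0 opprK -ratrD addNr (ratr_nat K 0).
Qed.

Lemma ratr_inj : injective (ratr : rat -> K).
Proof.
move=> x y /eqP; rewrite -subr_eq0 -ratrN -ratrD => h; apply/eqP.
rewrite -subr_eq0 -numq_eq0 -intf_eq0; move: h.
by rewrite /ratr mulf_eq0 invr_eq0 (intf_eq0 (denq _)) (negPf (denq_neq0 _)) orbF.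
Qed.

Lemma factf_neq0 n : (n`!)%:R != 0 :> K.
Proof. by rewrite natf_eq0 -lt0n fact_gt0. Qed.

Definition fbin (x : K) (n : nat) : K := (\prod_(k < n) (x - k%:R)) / (n`!)%:R.

Lemma ratr_qbin Q i : ratr (qbin Q i) = fbin (ratr Q) i.
Proof.
rewrite /qbin /fbin; elim: i => [|i IH].
  by rewrite !big_ord0 !invr1 mulr1 (ratr_nat K 1) mulr1.
have E (F : fieldType) (x p : F) : p * x / (i.+1`!)%:R = p / (i`!)%:R * (x / i.+1%:R).
  by rewrite factS mulnC natrM mulf_div.
rewrite !big_ord_recr !E ratrM IH; congr (_ * _).
have i0 : i.+1%:R != 0 :> rat by rewrite pnatr_eq0.
have i1 : i.+1%:R != 0 :> K by rewrite natf_eq0.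
apply: (mulIf i1); rewrite divfK // -[in LHS](ratr_natf i.+1) -ratrM divfK //.
by rewrite ratrD ratrN ratr_natf.
Qed.

Lemma fbin0 x : fbin x 0 = 1.
Proof. by rewrite /fbin big_ord0 divr1. Qed.

Lemma fbinS x n : n.+1%:R * fbin x n.+1 = (x - n%:R) * fbin x n.
Proof.
rewrite /fbin big_ord_recr factS natrM /=.
have i1 : n.+1%:R != 0 :> K by rewrite natf_eq0.
by field; rewrite factf_neq0 addrC natr1.
Qed.

Lemma fbin_pascal x n : fbin (x + 1) n.+1 = fbin x n.+1 + fbin x n.
Proof.
elim: n => [|n IH].
  have h y : fbin y 1 = y by rewrite /fbin big_ord1 subr0 divr1.
  by rewrite !h fbin0.
have i1 : n.+2%:R != 0 :> K by rewrite natf_eq0.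
apply: (mulfI i1); rewrite mulrDr !fbinS IH.
have := fbinS x n; rewrite -![n.+2%:R]natr1 -![n.+1%:R]natr1 => h.
set A := fbin x n.+1 in h *; set B := fbin x n in h *.
have -> : (x + 1 - (n%:R + 1)) * (A + B) = (x - (n%:R + 1)) * A + A + (x - n%:R) * B by ring.
by rewrite -h; ring.
Qed.

Lemma fbin_nat (k n : nat) : fbin k%:R n = 'C(k, n)%:R.
Proof.
elim: k n => [|k IH] [|n]; rewrite ?fbin0 ?bin0 //.
  by rewrite /fbin big_ord_recl subrr !mul0r.
by rewrite -natr1 fbin_pascal !IH binS natrD.
Qed.

Lemma fbin_0l n : fbin 0 n = (n == 0)%:R.
Proof. by rewrite -bin0n; apply: (fbin_nat 0). Qed.

(** Induction on n: multiply by n+1 = i + (n+1-i), let [fbinS] absorb each weight, and collect the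
    factor (x - i) + (y - (n - i)) = x + y - n. *)
Lemma fbin_vandermonde x y n :
  \sum_(i < n.+1) fbin x i * fbin y (n - i) = fbin (x + y) n.
Proof.
elim: n => [|n IH]; first by rewrite big_ord1 !fbin0 mulr1.
have i1 : n.+1%:R != 0 :> K by rewrite natf_eq0.
apply: (mulfI i1); rewrite fbinS -IH.
transitivity (\sum_(i < n.+2) i%:R * fbin x i * fbin y (n.+1 - i)
  + \sum_(i < n.+2) fbin x i * ((n.+1 - i)%:R * fbin y (n.+1 - i))).
  rewrite mulr_sumr -big_split; apply: eq_bigr => -[i /= hi] _.
  by rewrite natrB //; ring.
rewrite big_ord_recl /= !mul0r add0r [X in _ + X]big_ord_recr /= subnn mul0r mulr0 addr0.
rewrite -big_split mulr_sumr; apply: eq_bigr => -[i /= hi] _.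
rewrite /bump /= add1n subSS fbinS subSn // fbinS natrB //.
by ring.
Qed.

(** The matrix of binomials C(k,u) is unitriangular, so the coefficients vanish one after
    another. *)
Lemma fbin_sum_nat_eq0 L (c : nat -> K) :
  (forall k, (k < L)%N -> \sum_(u < L) c u * fbin k%:R u = 0) ->
  forall k, (k < L)%N -> c k = 0.
Proof.
move=> h; elim/ltn_ind => k IH hk.
have := h k hk; rewrite (bigD1 (Ordinal hk)) //= fbin_nat binn mulr1 big1 ?addr0 //.
move=> [u hu] /eqP hne; rewrite fbin_nat /=.
case: (ltngtP u k) => e; first by rewrite IH ?mul0r.
- by rewrite bin_small ?mulr0.
- by case: hne; apply: val_inj.
Qed.

(** A polynomial of degree below L with L distinct roots is zero, and its values at 0, ..., L-1 then
    determine the coefficients in the binomial basis. *)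
Lemma fbin_sum_eq0 L (x : 'I_L -> K) (c : nat -> K) : injective x ->
  (forall j, \sum_(u < L) c u * fbin (x j) u = 0) ->
  forall k, (k < L)%N -> c k = 0.
Proof.
move=> xI h.
pose b u : {poly K} := (u`!)%:R^-1 *: \prod_(k <- [seq k%:R | k <- iota 0 u]) ('X - k%:P).
have bE u y : (b u).[y] = fbin y u.
  rewrite /b hornerZ horner_prod mulrC /fbin big_map; congr (_ / _).
  have -> : iota 0 u = index_iota 0 u by rewrite /index_iota subn0.
  rewrite big_mkord; apply: eq_bigr => i _.
  by rewrite hornerXsubC.
have sb u : (size (b u) <= u.+1)%N.
  apply: leq_trans (size_scale_leq _ _) _.
  by rewrite size_prod_XsubC size_map size_iota.
pose p := \sum_(u < L) c u *: b u.
have pE y : p.[y] = \sum_(u < L) c u * fbin y u.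
  by rewrite horner_sum; apply: eq_bigr => u _; rewrite hornerZ bE.
have p0 : p = 0.
  apply: (@roots_geq_poly_eq0 _ _ (codom x)).
  - by apply/allP => y /codomP[j ->]; rewrite /root pE h.
  - by rewrite map_inj_uniq ?enum_uniq.
  - rewrite size_codom card_ord; apply: leq_trans (size_sum _ _ _) _.
    apply/bigmax_leqP => -[u hu] _ /=.
    exact: leq_trans (size_scale_leq _ _) (leq_trans (sb u) hu).
apply: fbin_sum_nat_eq0 => k hk.
by rewrite -pE p0 horner0.
Qed.

(** The square matrix of values has trivial left kernel by [fbin_sum_eq0], hence is invertible. *)
Lemma fbin_interpolation L (x y : 'I_L -> K) : injective x ->
  exists c : 'I_L -> K, forall j, \sum_u c u * fbin (x j) u = y j.
Proof.
move=> xI; pose M : 'M[K]_L := \matrix_(u, j) fbin (x j) u.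
have uM : M \in unitmx.
  rewrite -row_free_unit; apply: inj_row_free => v hv.
  pose c k := if insub k is Some u then v 0 u else 0.
  have cE (u : 'I_L) : c u = v 0 u by rewrite /c valK.
  apply/rowP => k; rewrite mxE -cE; apply: (fbin_sum_eq0 xI) => // j.
  have E : (v *m M) 0 j = 0 by rewrite hv mxE.
  rewrite -[RHS]E mxE.
  by apply: eq_bigr => u _; rewrite cE [M u j]mxE.
exists (fun u => (\row_j y j *m invmx M) 0 u) => j.
have E : (\row_j y j *m invmx M *m M) 0 j = y j by rewrite mulmxKV // mxE.
rewrite -[RHS]E mxE.
by apply: eq_bigr => u _; rewrite [M u j]mxE.
Qed.

End CharZero.

Lemma int_to_natK (z : int) : 0 <= z -> (int_to_nat z)%:Z = z.
Proof. by case: z. Qed.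

Lemma int_to_natE (z : int) (n : nat) : z = n%:Z -> int_to_nat z = n.
Proof. by move=> ->. Qed.

Lemma sum_indicator (K : fieldType) n (F : nat -> K) (j : nat) :
  \sum_(i < n) (if i == j :> nat then F i else 0) = if (j < n)%N then F j else 0.
Proof.
case: ifP => h.
  rewrite (bigD1 (Ordinal h)) //= eqxx big1 ?addr0 // => i hi.
  by case: ifP => // /eqP e; case/eqP: hi; apply: val_inj.
rewrite big1 // => -[i hi] _ /=; case: ifP => // /eqP e.
by rewrite -e hi in h.
Qed.

(** * The binomial transform and membership in O(N,Q,q;z) *)

Section BinomialTransform.
Variables (K : fieldType) (charK : [pchar K] =i pred0).

(* For f supported in degrees N - L < k <= N this is Res_z z^(-N-1) (1+z)^x f(z), a polynomial in x;
   membership in O(N,Q,q;z) means that it vanishes at x = t - Q for 0 <= t < N - q. *)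
Definition btrans (L : nat) (N : int) (f : int -> K) (x : K) : K :=
  \sum_(u < L) f (N - u%:Z) * fbin x u.

Lemma eq_btrans L N f g x : f =1 g -> btrans L N f x = btrans L N g x.
Proof. by move=> e; apply: eq_bigr => u _; rewrite e. Qed.

Lemma btransD L N f g x :
  btrans L N (fun k => f k + g k) x = btrans L N f x + btrans L N g x.
Proof. by rewrite -big_split; apply: eq_bigr => u _; rewrite mulrDl. Qed.

Lemma btransZ L N c f x : btrans L N (fun k => c * f k) x = c * btrans L N f x.
Proof. by rewrite mulr_sumr; apply: eq_bigr => u _; rewrite mulrA. Qed.

Lemma btrans_sum L N n (F : 'I_n -> int -> K) x :
  btrans L N (fun k => \sum_(i < n) F i k) x = \sum_(i < n) btrans L N (F i) x.
Proof.
rewrite exchange_big; apply: eq_bigr => u _ /=.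
by rewrite mulr_suml.
Qed.

Lemma btrans_monomial L N i c x : i <= N -> N - i < L%:Z ->
  btrans L N (fun k => if k == i then c else 0) x = c * fbin x (int_to_nat (N - i)).
Proof.
move=> hi hL; have hn : 0 <= N - i by lia.
have hn' := int_to_natK hn; set n := int_to_nat _ in hn' *.
rewrite /btrans -[RHS](_ : (if (n < L)%N then c * fbin x n else 0) = _); last first.
  by case: ifP => //; lia.
rewrite -(sum_indicator L (fun u => c * fbin x u)).
apply: eq_bigr => u _.
have -> : (N - u%:Z == i) = (u == n :> nat) by apply/eqP/eqP; lia.
by case: ifP; rewrite ?mul0r.
Qed.

Lemma btrans_widen L L' N f x : (L <= L')%N ->
  (forall k, k <= N - L%:Z -> f k = 0) -> btrans L' N f x = btrans L N f x.
Proof.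
move=> hL hf; rewrite /btrans -(subnKC hL) big_split_ord /= [X in _ + X]big1 ?addr0 //.
by move=> i _; rewrite hf ?mul0r //; lia.
Qed.

(** The generator is z^(q-t') (1+z)^Q cut off above z^N, so its transform is a Chu-Vandermonde
    convolution. The window L has to reach its lowest exponent N - D - t'. *)
Lemma btrans_Ogen (N : int) Q (q : int) (D t' L : nat) x : N - q = D%:Z -> (D + t' < L)%N ->
  btrans L N (fun k => \sum_(i < int_to_nat (N - q + t'%:Z + 1))
     (if k == i%:Z + q - t'%:Z then ratr (qbin Q i) else 0)) x
  = fbin (ratr Q + x) (D + t').
Proof.
move=> hD hL; have -> : int_to_nat (N - q + t'%:Z + 1) = (D + t').+1.
  by rewrite hD -!PoszD /= addn1.
rewrite btrans_sum -fbin_vandermonde //; apply: eq_bigr => -[i hi] _ /=.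
rewrite btrans_monomial; try lia.
rewrite ratr_qbin //; congr (_ * fbin _ _).
by apply: int_to_natE; lia.
Qed.

(** At x = t - Q a truncated binomial series transforms to C(t, D+t'), which is 0 for t < D;
    monomials above z^N are not seen. The bound [L0] exists because only finitely many generators
    occur. *)
Lemma Omem_btrans (N : int) Q (q : int) (D : nat) f : N - q = D%:Z -> Omem N Q q f ->
  exists L0, forall L t, (L0 <= L)%N -> (t < D)%N ->
    btrans L N f (t%:R - ratr Q) = 0.
Proof.
move=> hD [l [hl hf]].
suff: exists L0, forall L t, (L0 <= L)%N -> (t < D)%N ->
    btrans L N (fun k => \sum_(x <- l) x.1 * x.2 k) (t%:R - ratr Q) = 0.
  by move=> [L0 h]; exists L0 => L t *; rewrite -(h L t) //; apply: eq_btrans.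
elim: l hl {f hf} => [|[c g] l IH] hl.
  by exists 0%N => L t *; rewrite /btrans big1 // => i; rewrite big_nil mul0r.
have [|L1 h1] := IH; first by move=> y hy; apply: hl; right.
have [L2 h2] : exists L0, forall L t, (L0 <= L)%N -> (t < D)%N ->
    btrans L N g (t%:R - ratr Q) = 0.
  have /= [[i [hi hg]]|[t' hg]] := hl (c, g) (or_introl erefl).
    exists 0%N => L t _ _; rewrite /btrans big1 // => u _; rewrite hg.
    by rewrite (_ : _ == _ = false) ?mul0r //; apply/eqP; lia.
  exists (D + t').+1 => L t hL ht.
  rewrite (eq_btrans _ _ _ hg) (btrans_Ogen Q _ hD) // addrC subrK fbin_nat // bin_small //.
  by rewrite ltn_addr.
exists (maxn L1 L2) => L t; rewrite geq_max => /andP[a b] ht.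
rewrite -[LHS](@eq_btrans _ _ (fun k => c * g k + \sum_(x <- l) x.1 * x.2 k)); last first.
  by move=> k; rewrite big_cons.
by rewrite btransD btransZ h1 // h2 // mulr0 addr0.
Qed.

(** Induction on the width of the support: for width at most D the D distinct nodes force f = 0;
    otherwise a multiple of one generator removes the lowest term. *)
Lemma btrans_Omem (N : int) Q (q : int) (D L : nat) f : N - q = D%:Z ->
  (forall k : int, N < k \/ k <= N - L%:Z -> f k = 0) ->
  (forall t, (t < D)%N -> btrans L N f (t%:R - ratr Q) = 0) -> Omem N Q q f.
Proof.
move=> hD; elim: L f => [|L IH] f hf ht.
  exists [::]; split=> // k; rewrite big_nil; apply: hf.
  by case: (ltP N k); [left | right; lia].
have [hL|hL] := leqP L.+1 D.
  exists [::]; split=> // k; rewrite big_nil.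
  have h0 := @fbin_sum_eq0 K charK L.+1 (fun j => j%:R - ratr Q)
     (fun u => f (N - u%:Z)).
  case: (ltP N k) => h1; first by apply: hf; left.
  case: (leP k (N - (L.+1)%:Z)) => h2; first by apply: hf; right.
  have hn : 0 <= N - k by lia.
  have hn' := int_to_natK hn; set n := int_to_nat _ in hn' *.
  have -> : k = N - n%:Z by lia.
  apply: h0; last by lia.
    move=> i j /addIr /(natf_inj charK) h; exact: val_inj.
  move=> j; exact: (ht j (leq_trans (ltn_ord j) hL)).
(* The shift j = -(L - D) puts the lowest term of this generator at z^(N-L), with coefficient 1. *)
pose g (k : int) := \sum_(i < int_to_nat (N - q + (L - D)%N%:Z + 1))
     (if k == i%:Z + q - (L - D)%N%:Z then ratr (qbin Q i) else 0 : K).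
have gE : int_to_nat (N - q + (L - D)%N%:Z + 1) = L.+1.
  by rewrite hD -PoszD subnKC //= addn1.
have g0 (k : int) : N < k \/ k < N - L%:Z -> g k = 0.
  move=> hk; rewrite /g gE big1 // => -[i hi] _ /=.
  by case: ifP => // /eqP; lia.
have gL : g (N - L%:Z) = 1.
  rewrite /g gE big_ord_recl /= big1 ?addr0; last first.
    by move=> [i hi] _; rewrite /bump /=; case: ifP => // /eqP; lia.
  rewrite (_ : _ == _ = true); last by apply/eqP; lia.
  by rewrite ratr_qbin // fbin0.
pose c := f (N - L%:Z).
have [l [hl hE]] : Omem N Q q (fun k => f k + - c * g k).
  apply: IH => [k hk|t htD].
    have [->|hne] := eqVneq k (N - L%:Z); first by rewrite gL mulr1 subrr.
    rewrite hf ?g0 ?mulr0 ?addr0 //; move/eqP: hne; lia.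
  rewrite -(@btrans_widen L L.+1) //; last first.
    move=> k hk.
    have [->|hne] := eqVneq k (N - L%:Z); first by rewrite gL mulr1 subrr.
    rewrite hf ?g0 ?mulr0 ?addr0 //; move/eqP: hne; lia.
  rewrite btransD btransZ ht // (btrans_Ogen Q _ hD); last by lia.
  rewrite subnKC // [ratr Q + _]addrC subrK fbin_nat // bin_small ?mulr0 ?addr0 //.
  exact: leq_trans htD _.
exists ((c, g) :: l); split=> [y /= [<-|]|k]; last 2 first.
- exact: hl.
- by rewrite big_cons -hE /=; ring.
by right; exists (L - D)%N.
Qed.

(** By Pascal's rule a forward difference in x lowers the index u of [fbin x u] by one. The left
    side is thus the d-th difference at x0, which the values 0, ..., 0, 1 make equal to 1. *)
Lemma finite_difference_sum L (c : nat -> K) (x0 : K) d :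
  (forall k, (k <= d)%N -> \sum_(u < L) c u * fbin (x0 + k%:R) u = (k == d)%:R) ->
  \sum_(u < L) c u * (if (d <= u)%N then fbin x0 (u - d) else 0) = 1.
Proof.
move=> h.
(* Generalized to the e-th difference at x0 + k, which is nonzero only if it reaches the last node
   x0 + d. *)
suff H e k : (k + e <= d)%N ->
    \sum_(u < L) c u * (if (e <= u)%N then fbin (x0 + k%:R) (u - e) else 0)
    = (k + e == d)%N%:R.
  by have := H d 0%N (leqnn _); rewrite add0n eqxx addr0.
elim: e k => [|e IH] k hk.
  rewrite !addn0 in hk *; rewrite -[RHS]h //; apply: eq_bigr => u _.
  by rewrite subn0.
have := IH k.+1; have := IH k; rewrite addnS in hk.
move=> /(_ (ltnW hk)) h0 /(_ hk) h1.
have e0 : (k + e == d)%N = false by apply/eqP; lia.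
rewrite addnS -addSn -h1 -[RHS]subr0 -[X in _ - X](_ : (k + e == d)%N%:R = 0); last by rewrite e0.
rewrite -h0 -sumrB; apply: eq_bigr => u _; rewrite -mulrBr; congr (_ * _).
case: (ltngtP e u) => hu; rewrite ?subrr //.
  have -> : (u - e)%N = (u - e.+1).+1 by lia.
  by rewrite -natr1 addrA fbin_pascal //; ring.
by rewrite hu subnn !fbin0 subrr.
Qed.

End BinomialTransform.

(** * Idempotent polynomials and the transform of the product polynomial *)

Section Idempotents.
Variables (K : fieldType) (charK : [pchar K] =i pred0).
Variables (V : lmodType K) (A : VA V) (T : nat) (T0 : (0 < T)%N).

Local Notation Qv alpha mm s := (Qval T alpha (ld T mm) (dle s (lr T mm)) s).

(** Modulo integers Q_s is s/T, so the node t - Q_s determines s in [0,T) and then t. *)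
Lemma Qval_inj alpha mm (s s' : nat) (t t' : int) : (s < T)%N -> (s' < T)%N ->
  t%:~R - Qv alpha mm s = t'%:~R - Qv alpha mm s' -> s = s' /\ t = t'.
Proof.
move=> hs hs'; rewrite /Qval => h.
have Tr : T%:R != 0 :> rat by rewrite pnatr_eq0 -lt0n.
set z := alpha - 1 + (ld T mm)%:Z + _ in h.
set z' := alpha - 1 + (ld T mm)%:Z + _ in h.
have : (t - z - (t' - z')) * T%:Z = s%:Z - s'%:Z.
  apply/eqP; rewrite -(eqr_int rat) !(rmorphM, rmorphB) /= -!pmulrn.
  rewrite -[s%:R](divfK Tr) -[s'%:R](divfK Tr) -mulrBl; apply/eqP; congr (_ * _).
  by lra.
set X := t - z - _ => e.
have X0 : X = 0.
  clear -e hs hs'; clearbody X; case: (ltgtP X 0) => // hX.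
    have hX1 : X <= -1 by lia.
    by nia.
  have hX1 : 1 <= X by lia.
  by nia.
have hss : s = s' by apply/eqP; rewrite -eqz_nat -subr_eq0 -e X0 mul0r.
split=> //; subst s'; apply/eqP.
by move/eqP: X0; rewrite /X /z' /z -/z opprB addrA subrK subr_eq0.
Qed.

(** The congruences prescribe the transform at T D distinct nodes, matching the T D coefficients
    that [e] may have. *)
Lemma is_idem_exists nn mm alpha beta r i (D : nat) :
  Dv A T nn mm alpha beta = D%:Z -> (0 < D)%N -> i <= Nv A alpha beta -> (r < T)%N ->
  exists e, is_idem A T nn mm alpha beta r i e.
Proof.
move=> hD D0 hi hr; set N := Nv _ _ _ in hi *.
have hq : N - (- (ld T mm)%:Z - (ld T nn)%:Z - 3) = D%:Z.
  by rewrite -hD /Dv -/N; ring.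
(* The index j = s D + t encodes the node t - Q_s with 0 <= s < T and 0 <= t < D. *)
pose x (j : nat) : K := (j %% D)%:R - ratr (Qv alpha mm (j %/ D)).
have xinj : injective (fun j : 'I_(T * D) => x j).
  move=> j j'; rewrite /x.
  rewrite -!(ratr_natf K) -!ratrN // -!ratrD // => /(ratr_inj charK) h.
  have := Qval_inj (t := (j %% D)%N) (t' := (j' %% D)%N) _ _ h.
  case; try by rewrite ltn_divLR.
  move=> h1 [h2]; apply: val_inj => /=.
  by rewrite (divn_eq j D) (divn_eq j' D) h1 h2.
have hn' : (int_to_nat (N - i))%:Z = N - i by apply: int_to_natK; lia.
set n := int_to_nat _ in hn'.
have [c hc] := fbin_interpolation charK
  (fun j : 'I_(T * D) => if r == (j %/ D)%N then fbin (x j) n else 0) xinj.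
pose e (k : int) : K := \sum_(u < T * D) if k == N - u%:Z then c u else 0.
have eE (u : 'I_(T * D)) : e (N - u%:Z) = c u.
  rewrite /e (bigD1 u) //= eqxx big1 ?addr0 // => v hv.
  by case: ifP => // /eqP h; case/eqP: hv; apply: val_inj => /=; lia.
have e0 k : k < N + 1 - T%:Z * D%:Z \/ N < k -> e k = 0.
  move=> hk; rewrite /e big1 // => -[u hu] _ /=; case: ifP => // /eqP; lia.
exists e; split=> [k|s hs]; first by rewrite hD -/N; apply: e0.
(* The window is enlarged by n + 1 to contain z^i, which may lie below the support of [e]. *)
apply: (@btrans_Omem K charK _ _ _ D (T * D + n).+1 _ hq).
  move=> k hk; rewrite e0; last lia.
  by rewrite (_ : _ && _ = false) ?subr0 //; apply/negP=> /andP[_ /eqP]; lia.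
move=> t ht.
have hsD : (s * D + t < T * D)%N by nia.
have := hc (Ordinal hsD) => /=.
rewrite /x modnMDl modn_small // divnMDl // divn_small // addn0 => h.
transitivity (btrans (T * D + n).+1 N (fun k => e k
   + (-1) * (if k == i then (r == s)%:R else 0)) (t%:R - ratr (Qv alpha mm s))).
  apply: eq_btrans => k; rewrite mulN1r; congr (_ - _).
  by case: eqP; case: eqP.
rewrite btransD btransZ btrans_monomial //; last by lia.
rewrite (@btrans_widen _ (T * D)); [|lia|by move=> k hk; apply: e0; lia].
rewrite {1}/btrans (eq_bigr (fun u : 'I__ => c u * fbin (t%:R - ratr (Qv alpha mm s)) u)); last first.
  by move=> u _; rewrite eE.
rewrite h -/n; case: eqP => _; rewrite ?mul1r ?mul0r; ring.
Qed.

(** The polynomial picked by [epsilon] enters the proof only through this: at the nodes of residue r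
    its transform is that of z^i. *)
Lemma btrans_idem nn mm alpha beta r i (D t : nat) :
  Dv A T nn mm alpha beta = D%:Z -> i <= Nv A alpha beta -> (r < T)%N -> (t < D)%N ->
  btrans (T * D) (Nv A alpha beta) (idem A T nn mm alpha beta r i)
     (t%:R - ratr (Qv alpha mm r))
  = fbin (t%:R - ratr (Qv alpha mm r)) (int_to_nat (Nv A alpha beta - i)).
Proof.
move=> hD hi hr ht; have D0 : (0 < D)%N by lia.
set N := Nv _ _ _ in hi *.
have hq : N - (- (ld T mm)%:Z - (ld T nn)%:Z - 3) = D%:Z.
  by rewrite -hD /Dv -/N; ring.
have -> : idem A T nn mm alpha beta r i
   = ClassicalEpsilon.epsilon (inhabits (fun _ => 0)) (is_idem A T nn mm alpha beta r i).
  rewrite /idem ifN // hD negb_or -/N; apply/andP; split; lia.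
have := is_idem_exists hD D0 hi hr.
move/(ClassicalEpsilon.epsilon_spec (inhabits (fun _ => 0))).
set e := ClassicalEpsilon.epsilon _ _; case=> e0 /(_ r hr) h.
have [L0 hL] := Omem_btrans charK hq h.
have hn' : (int_to_nat (N - i))%:Z = N - i by apply: int_to_natK; lia.
set n := int_to_nat _ in hn' *.
set L := (L0 + T * D + n).+1.
have hLL : (L0 <= L)%N by rewrite /L; lia.
have hLt := hL L t hLL ht.
rewrite -(@btrans_widen _ (T * D) L); first last.
- by move=> k hk; apply: e0; rewrite hD -/N; left; lia.
- by rewrite /L; lia.
have -> : fbin (t%:R - ratr (Qv alpha mm r)) n = btrans L N
    (fun k : int => if k == i then 1 else 0 : K) (t%:R - ratr (Qv alpha mm r)).
  rewrite btrans_monomial ?mul1r // /L; lia.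
apply: subr0_eq; rewrite -[RHS]hLt -[- btrans _ _ _ _]mulN1r -btransZ -btransD.
apply: eq_btrans => k.
by rewrite eqxx mulN1r.
Qed.

Lemma angle_lt nn pp : (angle T nn pp < T)%N.
Proof.
rewrite /angle; have h : T%:Z != 0 by rewrite -lt0n.
have h1 := modz_ge0 (pp%:Z - nn%:Z) h.
have h2 := ltz_pmod (pp%:Z - nn%:Z) (d := T%:Z) T0.
have := int_to_natK h1; lia.
Qed.

(** The form mu = -t0 - 1 occurs for p = n with t0 = l1 and for p = m with t0 = l3. At these nodes
    each idempotent acts as its monomial, and Chu-Vandermonde turns the i-th residue into C(t0 + k,
    t0 + d + i). *)
Lemma btrans_Ppoly nn pp mm alpha beta (D d t0 k : nat) :
  let r := angle T nn pp in
  Dv A T nn mm alpha beta = D%:Z -> Nv A alpha beta + 1 = d%:Z ->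
  (ld T pp)%:Z - (ld T mm)%:Z - (ld T nn)%:Z
     - (dle r (lr T mm))%:Z - (dle T (r + lr T nn))%:Z = - t0%:Z - 1 ->
  (t0 + d < D)%N -> (k <= d)%N ->
  btrans (T * D) (Nv A alpha beta) (Ppoly A T nn pp mm alpha beta)
     ((t0 + k)%:R - ratr (Qv alpha mm r)) = (k == d)%:R.
Proof.
move=> r hD hd hmu hlt hk; set N := Nv _ _ _ in hd *.
pose F (i : nat) : K := ratr (qbin (- t0%:Z - 1)%:~R i) * fbin (t0 + k)%:R (t0 + d + i).
transitivity (\sum_(i < (ld T pp).+1) F i).
  rewrite /Ppoly -/r hmu.
  rewrite (btrans_sum _ _ (fun (i : 'I__) k => ratr (qbin (- t0%:Z - 1)%:~R i) *
     \sum_(j < int_to_nat (Nv A alpha beta - (- t0%:Z - 1) + i%:Z + 1))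
      ratr (qbin (Qv alpha mm r) j)
      * idem A T nn mm alpha beta r (j%:Z + (- t0%:Z - 1) - i%:Z) k)).
  apply: eq_bigr => -[i hi] _ /=.
  rewrite btransZ -/N; congr (_ * _).
  have -> : int_to_nat (N - (- t0%:Z - 1) + i%:Z + 1) = (t0 + d + i).+1.
    by apply: int_to_natE; lia.
  rewrite (btrans_sum _ _ (fun (j : 'I__) k => ratr (qbin (Qv alpha mm r) j)
      * idem A T nn mm alpha beta r (j%:Z + (- t0%:Z - 1) - i%:Z) k)).
  rewrite -[(t0 + k)%:R in RHS](subrK (ratr (Qv alpha mm r))) [_ - _ + _]addrC -fbin_vandermonde //.
  apply: eq_bigr => -[j hj] _ /=.
  rewrite btransZ btrans_idem //; first last.
  - lia.
  - exact: angle_lt.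
  - rewrite -/N; lia.
  rewrite ratr_qbin // -/N; congr (_ * fbin _ _).
  by apply: int_to_natE; lia.
(* As k <= d, the binomial is nonzero only for i = 0 and k = d. *)
rewrite big_ord_recl {1}/F /= addn0 ratr_qbin // fbin0 mul1r fbin_nat // big1 ?addr0.
  have [->|h] := eqVneq k d; first by rewrite binn.
  by rewrite bin_small //; move/eqP: h; lia.
by move=> i _; rewrite /F fbin_nat // bin_small ?mulr0 // /bump /=; lia.
Qed.

Lemma homstarE nn pp mm alpha beta (D : nat) a b :
  Dv A T nn mm alpha beta = D%:Z ->
  homstar A T nn pp mm alpha beta a b
  = \sum_(u < T * D) Ppoly A T nn pp mm alpha beta (Nv A alpha beta - u%:Z)
       *: va_nprod A (Nv A alpha beta - u%:Z) a b.
Proof.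
move=> hD; rewrite /homstar hD -PoszM /= (reindex_inj rev_ord_inj) /=.
apply: eq_bigr => -[u hu] _ /=.
have -> : Nv A alpha beta + 1 - (T * D)%N%:Z + (T * D - u.+1)%N%:Z = Nv A alpha beta - u%:Z by lia.
by [].
Qed.

End Idempotents.

(** * Linear spans and congruences modulo them *)

Section Span.
Variables (K : fieldType) (V : lmodType K) (S : V -> Prop).

Lemma vspan0 : vspan S 0.
Proof. by exists [::]; rewrite big_nil. Qed.

Lemma vspanZD k x y : vspan S x -> vspan S y -> vspan S (k *: x + y).
Proof.
move=> [l [hl ->]] [l' [hl' ->]].
exists ([seq (k * z.1, z.2) | z <- l] ++ l'); split.
  move=> z /(@List.in_app_or _ _ _ _) [|]; last exact: hl'.
  elim: l hl => //= w l IH hl [<-|]; first by apply: (hl w); left.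
  by apply: IH => v hv; apply: hl; right.
rewrite big_cat big_map scaler_sumr; congr (_ + _).
by apply: eq_bigr => z _; rewrite scalerA.
Qed.

Lemma vspanD x y : vspan S x -> vspan S y -> vspan S (x + y).
Proof. by move=> hx hy; rewrite -[x]scale1r; apply: vspanZD. Qed.

Lemma vspanZ k x : vspan S x -> vspan S (k *: x).
Proof. by move=> hx; rewrite -[_ *: _]addr0; apply: vspanZD => //; apply: vspan0. Qed.

Lemma vspanN x : vspan S x -> vspan S (- x).
Proof. by rewrite -scaleN1r; apply: vspanZ. Qed.

Lemma vspanB x y : vspan S x -> vspan S y -> vspan S (x - y).
Proof. by move=> hx /vspanN; apply: vspanD. Qed.

Lemma vspan_trans x y z : vspan S (x - y) -> vspan S (y - z) -> vspan S (x - z).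
Proof. by move=> h /(vspanD h); rewrite addrA subrK. Qed.

Lemma vspan_subr x y : vspan S (x - y) -> vspan S y -> vspan S x.
Proof. by move=> h /(vspanD h); rewrite subrK. Qed.

Lemma vspan_sum (I : Type) (r : seq I) (F : I -> V) :
  (forall i, vspan S (F i)) -> vspan S (\sum_(i <- r) F i).
Proof. by move=> h; apply: big_ind => //; [apply: vspan0 | apply: vspanD]. Qed.

Lemma mem_vspan x : S x -> vspan S x.
Proof.
move=> hx; exists [:: (1, x)]; split; first by move=> y [<-|[]].
by rewrite big_seq1 scale1r.
Qed.

Lemma vspan_ind (P : V -> Prop) :
  P 0 -> (forall k x y, P x -> P y -> P (k *: x + y)) ->
  (forall x, S x -> P x) -> forall x, vspan S x -> P x.
Proof.
move=> P0 PZD PS x [l [hl ->]]; elim: l hl => [|y l IH] hl.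
  by rewrite big_nil.
rewrite big_cons; apply: PZD; first by apply: PS; apply: hl; left.
by apply: IH => z hz; apply: hl; right.
Qed.

End Span.

(** * Bilinearity of the products *)

Section Products.
Variables (K : fieldType) (charK : [pchar K] =i pred0).
Variables (V : lmodType K) (A : VA V) (T : nat) (T0 : (0 < T)%N).

Local Notation nprod := (va_nprod A).
Local Notation vac := (va_vac A).
Local Notation Delta := (va_Delta A).
Local Notation gpr := (va_gpr A).
Local Notation gsupp := (va_gsupp A).
Local Notation star := (star A T).
Local Notation O := (Onm A T).
Local Notation Qv alpha mm s := (Qval T alpha (ld T mm) (dle s (lr T mm)) s).

Lemma linear_at0 (W : lmodType K) (f : V -> W) :
  (forall k x y, f (k *: x + y) = k *: f x + f y) -> f 0 = 0.
Proof. by move=> /(_ (-1) 0 0); rewrite scaler0 addr0 scaleN1r addNr. Qed.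

Lemma gpr0 k : gpr k 0 = 0.
Proof. by apply: linear_at0 => *; apply: va_gpr_lin. Qed.

Lemma nprod0r i a : nprod i a 0 = 0.
Proof. by apply: (linear_at0 (f := nprod i a)) => *; apply: va_nprod_linr. Qed.

Lemma homstar_linl nn pp mm alpha beta k a a' b :
  homstar A T nn pp mm alpha beta (k *: a + a') b
  = k *: homstar A T nn pp mm alpha beta a b + homstar A T nn pp mm alpha beta a' b.
Proof.
rewrite /homstar scaler_sumr -big_split; apply: eq_bigr => t _.
by rewrite va_nprod_linl scalerDr !scalerA mulrC.
Qed.

Lemma homstar_linr nn pp mm alpha beta k a b b' :
  homstar A T nn pp mm alpha beta a (k *: b + b')
  = k *: homstar A T nn pp mm alpha beta a b + homstar A T nn pp mm alpha beta a b'.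
Proof.
rewrite /homstar scaler_sumr -big_split; apply: eq_bigr => t _.
by rewrite va_nprod_linr scalerDr !scalerA mulrC.
Qed.

(** Projecting [va_gsupp_sum] to weight k leaves one copy of the component per occurrence of k; in
    characteristic zero a nonzero component therefore occurs exactly once. *)
Lemma gpr_count k v : gpr k v = gpr k v *+ count_mem k (gsupp v).
Proof.
rewrite {1}[v](va_gsupp_sum A); elim: (gsupp v) => [|l s IH].
  by rewrite big_nil gpr0.
rewrite big_cons /= -[gpr l v]scale1r va_gpr_lin scale1r IH va_gpr_orth eq_sym mulrnDr.
by case: eqP => [->|]; rewrite ?mulr1n ?mulr0n.
Qed.

(* The list gsupp v may repeat a weight, but not one with a nonzero component. *)
Lemma sum_gsupp (W : lmodType K) (F : int -> V -> W) v (L : seq int) :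
  (forall k, F k 0 = 0) -> uniq L -> {subset gsupp v <= L} ->
  \sum_(k <- gsupp v) F k (gpr k v) = \sum_(k <- L) F k (gpr k v).
Proof.
move=> F0 uL sL.
rewrite -big_undup_iterop_count /=.
transitivity (\sum_(k <- undup (gsupp v)) F k (gpr k v)).
  rewrite big_seq [RHS]big_seq; apply: eq_bigr => k; rewrite mem_undup => hk.
  rewrite -[LHS]/(F k (gpr k v) *+ count_mem k (gsupp v)).
  have [->|h0] := eqVneq (gpr k v) 0.
    by rewrite F0 mul0rn.
  have hc : count_mem k (gsupp v) = 1%N.
    have := gpr_count k v; move: (count_mem _ _) => n.
    have [->|[->//|hn]] : n = 0%N \/ n = 1%N \/ (1 < n)%N by lia.
      by rewrite mulr0n => /eqP; rewrite (negPf h0).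
    rewrite -[in LHS](mulr1n (gpr k v)) -(subnK (ltnW hn)) mulrnDr.
    move/eqP; rewrite eq_sym -subr_eq0 addrK -scaler_nat scaler_eq0 (negPf h0) orbF.
    by rewrite natf_eq0 //; lia.
  by rewrite hc.
rewrite [RHS](bigID (mem (gsupp v))) /= [X in _ + X]big1 ?addr0; last first.
  by move=> k hk; rewrite va_gsupp_out ?F0.
rewrite -[RHS]big_filter; apply: perm_big; apply: uniq_perm.
- exact: undup_uniq.
- exact: filter_uniq.
move=> k; rewrite mem_undup mem_filter.
by case: (boolP (k \in gsupp v)) => // /sL ->.
Qed.

Lemma sum_gsupp_homog (W : lmodType K) (F : int -> V -> W) alpha a :
  (forall k, F k 0 = 0) -> homog A alpha a ->
  \sum_(k <- gsupp a) F k (gpr k a) = F alpha a.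
Proof.
(* Adjoining [alpha] covers the case a = 0, where [gsupp a] may miss it. *)
move=> F0 ha; pose L := undup (alpha :: gsupp a).
have hL : alpha \in L by rewrite mem_undup mem_head.
have sL : {subset gsupp a <= L} by move=> k hk; rewrite mem_undup inE hk orbT.
have uL : uniq L by exact: undup_uniq.
clearbody L; rewrite (sum_gsupp F0 uL sL) (big_rem alpha) //= ha.
rewrite big_seq big1 ?addr0 // => k.
rewrite mem_rem_uniq // => /andP[/negPf hk _].
by rewrite -ha va_gpr_orth hk F0.
Qed.

(** The three support lists need not be related, so each sum is moved to one duplicate-free list
    containing them all. *)
Lemma sum_gsupp_linear (W : lmodType K) (F : int -> V -> W) :
  (forall i k x y, F i (k *: x + y) = k *: F i x + F i y) ->
  forall k x y, \sum_(i <- gsupp (k *: x + y)) F i (gpr i (k *: x + y))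
    = k *: (\sum_(i <- gsupp x) F i (gpr i x)) + \sum_(i <- gsupp y) F i (gpr i y).
Proof.
move=> hF k x y; have F0 i : F i 0 = 0 by apply: linear_at0 => *; apply: hF.
pose L := undup (gsupp (k *: x + y) ++ gsupp x ++ gsupp y).
have uL : uniq L by exact: undup_uniq.
rewrite !(@sum_gsupp _ _ _ L) //; last first.
- by move=> i hi; rewrite mem_undup !mem_cat hi.
- by move=> i hi; rewrite mem_undup !mem_cat hi !orbT.
- by move=> i hi; rewrite mem_undup !mem_cat hi !orbT.
rewrite scaler_sumr -big_split; apply: eq_bigr => i _.
by rewrite va_gpr_lin hF.
Qed.

Lemma star_linl nn pp mm k a a' b :
  star nn pp mm (k *: a + a') b = k *: star nn pp mm a b + star nn pp mm a' b.
Proof.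
apply: (sum_gsupp_linear (F := fun i x => \sum_(beta <- gsupp b)
  homstar A T nn pp mm i beta x (gpr beta b))) => i c x y.
rewrite scaler_sumr -big_split; apply: eq_bigr => beta _.
exact: homstar_linl.
Qed.

Lemma star_linr nn pp mm k a b b' :
  star nn pp mm a (k *: b + b') = k *: star nn pp mm a b + star nn pp mm a b'.
Proof.
rewrite /Defs.star scaler_sumr -big_split; apply: eq_bigr => alpha _.
apply: (sum_gsupp_linear (F := fun i x => homstar A T nn pp mm alpha i (gpr alpha a) x)).
by move=> *; apply: homstar_linr.
Qed.

Lemma star0l nn pp mm b : star nn pp mm 0 b = 0.
Proof. by apply: (linear_at0 (f := fun x => star nn pp mm x b)) => *; apply: star_linl. Qed.

Lemma star0r nn pp mm a : star nn pp mm a 0 = 0.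
Proof. by apply: (linear_at0 (f := star nn pp mm a)) => *; apply: star_linr. Qed.

Lemma starBl nn pp mm a a' b :
  star nn pp mm (a - a') b = star nn pp mm a b - star nn pp mm a' b.
Proof. by rewrite addrC -scaleN1r star_linl scaleN1r addrC. Qed.

Lemma starBr nn pp mm a b b' :
  star nn pp mm a (b - b') = star nn pp mm a b - star nn pp mm a b'.
Proof. by rewrite addrC -scaleN1r star_linr scaleN1r addrC. Qed.

Lemma homstar0l nn pp mm alpha beta b : homstar A T nn pp mm alpha beta 0 b = 0.
Proof.
by apply: (linear_at0 (f := fun x => homstar A T nn pp mm alpha beta x b)) => *; apply: homstar_linl.
Qed.

Lemma homstar0r nn pp mm alpha beta a : homstar A T nn pp mm alpha beta a 0 = 0.
Proof.
by apply: (linear_at0 (f := homstar A T nn pp mm alpha beta a)) => *; apply: homstar_linr.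
Qed.

(** * The left unit law *)

Lemma homog_ge_Delta k a : homog A k a -> a <> 0 -> Delta <= k.
Proof.
by move=> ha a0; case: leP => // hk; case: a0; rewrite -ha va_gpr_below.
Qed.

Lemma angle_eq nn pp : angle T nn pp =
  (if (lr T nn <= lr T pp)%N then lr T pp - lr T nn else lr T pp + T - lr T nn)%N.
Proof.
have h1 : (lr T nn < T)%N by rewrite ltn_mod.
have h2 : (lr T pp < T)%N by rewrite ltn_mod.
apply: int_to_natE; rewrite [in LHS](divn_eq pp T) [in LHS](divn_eq nn T).
rewrite -!/(lr _ _) -!/(ld _ _) !PoszD !PoszM.
case: ifP => h.
  have -> : (ld T pp)%:Z * T%:Z + (lr T pp)%:Z - ((ld T nn)%:Z * T%:Z + (lr T nn)%:Z)
    = ((ld T pp)%:Z - (ld T nn)%:Z) * T%:Z + (lr T pp - lr T nn)%N%:Z.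
    by rewrite -subzn //; ring.
  by rewrite modzMDl modz_small //; lia.
have -> : (ld T pp)%:Z * T%:Z + (lr T pp)%:Z - ((ld T nn)%:Z * T%:Z + (lr T nn)%:Z)
    = ((ld T pp)%:Z - (ld T nn)%:Z - 1) * T%:Z + (lr T pp + T - lr T nn)%N%:Z.
  by rewrite -subzn ?PoszD; [ring|lia].
by rewrite modzMDl modz_small //; lia.
Qed.

Lemma angle_refl nn : angle T nn nn = 0%N.
Proof. by rewrite angle_eq leqnn subnn. Qed.

(** The finite difference at base point 0 extracts the coefficient of z^(-1), and the mode -1 is the
    only one through which the vacuum acts. *)
Lemma homstar_vac_left nn mm beta b : homog A beta b ->
  homstar A T nn nn mm 0 beta vac b = b.
Proof.
move=> hb; have [->|/eqP b0] := eqVneq b 0; first exact: homstar0r.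
have hge := homog_ge_Delta hb b0.
(* Nonzero b has weight at least [Delta], so N + 1 is a natural number d. *)
have hd : Nv A 0 beta + 1 = (int_to_nat (beta - Delta))%:Z.
  by rewrite int_to_natK /Nv; lia.
set d := int_to_nat _ in hd.
have hD : Dv A T nn mm 0 beta = (ld T mm + d + ld T nn + 2)%N%:Z by rewrite /Dv; lia.
set D := (_ + 2)%N in hD; have hlt : (ld T mm + d < D)%N by rewrite /D; lia.
rewrite (homstarE _ _ _ _ hD) //.
have dl0 : dle 0 (lr T mm) = 1%N by [].
have dlT : dle T (0 + lr T nn) = 0%N.
  by rewrite /dle add0n leqNgt ltn_mod T0.
have hP k := @btrans_Ppoly K charK V A T T0 nn nn mm 0 beta D d (ld T mm) k hD hd.
rewrite angle_refl dl0 dlT in hP.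
(* Here r = 0 and Q_0 = l1, so the nodes are 0, ..., d. *)
have x0 k : (ld T mm + k)%:R - ratr (Qval T 0 (ld T mm) 1 0) = 0 + k%:R :> K.
  have -> : Qval T 0 (ld T mm) 1 0 = (ld T mm)%:R.
    rewrite /Qval mul0r addr0 pmulrn; congr (_%:~R); lia.
  by rewrite ratr_natf natrD; ring.
have S := finite_difference_sum charK (L := T * D)
  (c := fun u => Ppoly A T nn nn mm 0 beta (Nv A 0 beta - u%:Z)) (x0 := 0) (d := d).
rewrite -[RHS]scale1r -S; last first.
  move=> k hk; rewrite -x0; apply: hP => //; lia.
rewrite scaler_suml; apply: eq_bigr => u _.
rewrite va_vac_left -scalerA; congr (_ *: _).
case: (ltngtP d u) => hu.
- rewrite (_ : _ == _ = false); last by apply/eqP; lia.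
  by rewrite fbin_0l // (_ : _ == _ = false) ?scale0r //; apply/eqP; lia.
- rewrite (_ : _ == _ = false) ?scale0r //; apply/eqP; lia.
- by rewrite -hu subnn fbin0 scale1r (_ : _ == _) //; apply/eqP; lia.
Qed.

Lemma star_vac_left nn mm b : star nn nn mm vac b = b.
Proof.
rewrite /Defs.star (sum_gsupp_homog (F := fun alpha a => \sum_(beta <- gsupp b)
  homstar A T nn nn mm alpha beta a (gpr beta b)) (alpha := 0)); first last.
- exact: va_vac_wt0.
- by move=> k; rewrite big1 // => i _; apply: homstar0l.
rewrite [RHS](va_gsupp_sum A); apply: eq_bigr => beta _.
by rewrite homstar_vac_left // /homog va_gpr_orth eqxx.
Qed.

(** * The right unit law modulo [Onm] *)

Lemma fbin_absorb x n : n.+1%:R * fbin (x + 1) n.+1 = (x + 1) * fbin x n :> K.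
Proof. by rewrite fbin_pascal // mulrDr fbinS // -natr1; ring. Qed.

Lemma fbin_neg2 n : (-1) ^+ n * fbin (- 2) n = n.+1%:R :> K.
Proof.
elim: n => [|n IH]; first by rewrite fbin0 mulr1.
have i1 : n.+1%:R != 0 :> K by rewrite natf_eq0.
apply: (mulfI i1); rewrite mulrCA fbinS // exprS mulN1r mulNr mulrCA IH.
by rewrite -![n.+2%:R]natr1 -![n.+1%:R]natr1; ring.
Qed.

(** Borcherds identity with b = c = 1, p = 0, q = -1 - j, r = -2: the left side keeps i = 0, the
    right side i = j with coefficient (-1)^j C(-2,j) = j + 1. *)
Lemma nprod_derivation_vac a (j : nat) :
  nprod (-1 - j%:Z) (nprod (-2) a vac) vac = j.+1%:R *: nprod (- 2 - j%:Z) a vac.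
Proof.
have [M0 hB] := va_borcherds A a vac vac 0 (-1 - j%:Z) (-2).
(* The partial sum is taken long enough to include the index j. *)
have hM : (M0 <= (M0 + j).+1)%N by lia.
have hj : (j < (M0 + j).+1)%N by lia.
have := hB _ hM; rewrite [X in X = _ -> _]big_ord_recl [X in _ + X = _ -> _]big1 ?addr0; last first.
  move=> i _; rewrite ratr_qbin // (ratr_nat K 0) fbin_0l // scale0r //.
rewrite ratr_qbin // fbin0 scale1r /= add0r => ->.
rewrite (bigD1 (Ordinal hj)) //= [X in _ + X]big1 ?addr0; last first.
  move=> i hi; rewrite va_vac_left (_ : _ == _ = false); last first.
    by apply/eqP => h; case/eqP: hi; apply: val_inj => /=; lia.
  rewrite va_vac_right_pos //.
  by rewrite !nprod0r scaler0 subr0 scaler0.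
rewrite subrK (va_vac_left A (-1) vac) eqxx [nprod (0 + _) a vac]va_vac_right_pos //.
rewrite nprod0r scaler0 subr0 ratr_qbin // add0r; congr (_ *: _).
by rewrite -fbin_neg2 ratrN // ratr_natf.
Qed.

Lemma homog_nprod2_vac k a : homog A k a -> homog A (k + 1) (nprod (-2) a vac).
Proof.
move=> ha; have := va_nprod_wt A k 0 (-2) a vac.
by rewrite ha va_vac_wt0 /homog; have -> : k - 1 - -2 + 0 = k + 1 by ring.
Qed.

(* Modulo O_0 the operator a |-> a_{-2}1 acts on weight k as the scalar n - m - k. *)
Definition vacexp (nn mm : nat) (k : int) : K :=
  - ratr (k%:~R + (mm%:R - nn%:R) / T%:R).

(** Up to j! the left vector is the j-fold image of a under a |-> a_{-2}1. Each application raises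
    the weight and lowers the scalar [vacexp] by one, so the scalars multiply to a falling
    factorial. *)
Lemma nprod_vac_congr nn mm (j : nat) k a : homog A k a ->
  O nn mm (nprod (-1 - j%:Z) a vac - fbin (vacexp nn mm k) j *: a).
Proof.
elim: j k a => [|j IH] k a ha.
  by rewrite subr0 va_vac_right_m1 fbin0 scale1r subrr; apply: vspan0.
have i1 : j.+1%:R != 0 :> K by rewrite natf_eq0.
have xE : vacexp nn mm k = vacexp nn mm (k + 1) + 1.
  by rewrite /vacexp intrD addrAC [in RHS]ratrD // opprD ratr_int mulr1z subrK.
have h1 := IH _ _ (homog_nprod2_vac ha); rewrite nprod_derivation_vac in h1.
have h2 : O nn mm (nprod (-2) a vac - vacexp nn mm k *: a).
  apply: mem_vspan; left; exists k, a; split=> //.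
  by rewrite /vacexp scaleNr opprK.
(* With x = [vacexp nn mm k], the two congruences give (j+1) a_{-2-j}1 = C(x-1,j) a_{-2}1 = x
   C(x-1,j) a modulo O, and x C(x-1,j) = (j+1) C(x,j+1). *)
have := vspanZ (j.+1%:R^-1) (vspanZD (fbin (vacexp nn mm (k + 1)) j) h2 h1).
rewrite scalerBr [X in _ *: X]addrC addrA subrK !scalerBr !scalerA mulVf // scale1r.
congr (O nn mm (nprod _ _ _ - _ *: a)); first by lia.
by apply: (mulfI i1); rewrite -mulrA mulVKf // xE fbin_absorb [RHS]mulrC.
Qed.

(** By [nprod_vac_congr] the vacuum acts through binomials of [vacexp], and this is exactly the base
    point of the nodes for p = m, so the finite difference formula gives total scalar 1. *)
Lemma homstar_vac_right nn mm alpha a : homog A alpha a ->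
  O nn mm (homstar A T nn mm mm alpha 0 a vac - a).
Proof.
move=> ha; have [->|/eqP a0] := eqVneq a 0.
  by rewrite homstar0l subr0; apply: vspan0.
have hge := homog_ge_Delta ha a0.
have hd : Nv A alpha 0 + 1 = (int_to_nat (alpha - Delta))%:Z.
  by rewrite int_to_natK /Nv; lia.
set d := int_to_nat _ in hd.
have hD : Dv A T nn mm alpha 0 = (ld T nn + d + ld T mm + 2)%N%:Z by rewrite /Dv; lia.
set D := (_ + 2)%N in hD; have hlt : (ld T nn + d < D)%N by rewrite /D; lia.
rewrite (homstarE _ _ _ _ hD) //.
have h1 : (lr T nn < T)%N by rewrite ltn_mod.
have h2 : (lr T mm < T)%N by rewrite ltn_mod.
set r := angle T nn mm.
(* r + i3 is i1 or i1 + T, the latter exactly when r > i1. So one of the two delta terms of mu is 1,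
   and mu = -l3 - 1. *)
have [dl hr] : (dle r (lr T mm) + dle T (r + lr T nn) = 1)%N /\
    (r + lr T nn = lr T mm + T * (1 - dle r (lr T mm)))%N.
  rewrite /dle /r angle_eq; case: (leqP (lr T nn) (lr T mm)) => h.
    by rewrite leq_subr subnK // leqNgt h2 subnn muln0 addn0.
  rewrite ifN ?subn0 ?muln1; last by rewrite -ltnNge; lia.
  by rewrite subnK; [rewrite leq_addl | lia].
have hP k := @btrans_Ppoly K charK V A T T0 nn mm mm alpha 0 D d (ld T nn) k hD hd.
rewrite -/r in hP.
(* Dividing [hr] by T turns l3 - Q_r into -(alpha + m - n). *)
have x0 k : (ld T nn + k)%:R - ratr (Qv alpha mm r) = vacexp nn mm alpha + k%:R.
  rewrite /vacexp natrD addrAC; congr (_ + _).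
  rewrite -[(ld T nn)%:R]ratr_natf -!ratrN // -ratrD //; congr ratr.
  have hN x : x%:R = (ld T x)%:R * T%:R + (lr T x)%:R :> rat.
    by rewrite -natrM -natrD -divn_eq.
  rewrite /Qval (hN mm) (hN nn).
  have Tr : T%:R != 0 :> rat by rewrite pnatr_eq0 -lt0n.
  move/(congr1 (fun n => n%:R : rat)): hr.
  rewrite !(natrD, natrM) natrB /=; last by rewrite /dle; case: ifP.
  move=> hr; have -> : r%:R = (lr T mm)%:R + T%:R * (1%:R - (dle r (lr T mm))%:R) - (lr T nn)%:R :> rat.
    by rewrite -hr addrK.
  by rewrite !(rmorphD, rmorphB) /= -!pmulrn mulrN1z; field.
have S := finite_difference_sum charK (L := T * D)
  (c := fun u => Ppoly A T nn mm mm alpha 0 (Nv A alpha 0 - u%:Z))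
  (x0 := vacexp nn mm alpha) (d := d).
rewrite -{2}[a]scale1r -S; last first.
  move=> k hk; rewrite -x0; apply: hP => //; lia.
rewrite scaler_suml -sumrB; apply: vspan_sum => u.
rewrite -scalerA -scalerBr; apply: vspanZ.
(* For u < d the mode N - u is nonnegative and kills the vacuum; the others are -1 - (u - d). *)
case: leqP => hu; last first.
  by rewrite va_vac_right_pos ?scale0r ?subr0; [apply: vspan0 | lia].
have -> : Nv A alpha 0 - u%:Z = -1 - (u - d)%N%:Z by lia.
exact: nprod_vac_congr.
Qed.

Lemma star_vac_right nn mm a : O nn mm (star nn mm mm a vac - a).
Proof.
rewrite {2}[a](va_gsupp_sum A) -sumrB; apply: vspan_sum => alpha.
rewrite (sum_gsupp_homog (F := fun beta b => homstar A T nn mm mm alpha beta (gpr alpha a) b) (alpha := 0)).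
- by apply: homstar_vac_right; rewrite /homog va_gpr_orth eqxx.
- by move=> k; apply: homstar0r.
- exact: va_vac_wt0.
Qed.

(** * Associativity, stability of the family [Onm], and the conclusion *)

Lemma star_assoc_left nn mm p1 p2 p3 u a b c :
  O nn mm (star nn p3 mm u (star p3 p1 mm (star p3 p2 p1 a b) c)
           - star nn p3 mm u (star p3 p2 mm a (star p2 p1 mm b c))).
Proof.
by rewrite -starBr; apply: mem_vspan; right; right; left; exists a, b, c, u, p1, p2, p3.
Qed.

(** Take u = 1 in an O_2 generator; the exact left unit law removes it. *)
Lemma star_assoc nn mm p1 p2 a b c :
  O nn mm (star nn p1 mm (star nn p2 p1 a b) c - star nn p2 mm a (star p2 p1 mm b c)).
Proof. by have := star_assoc_left nn mm p1 p2 nn vac a b c; rewrite !star_vac_left. Qed.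

(** Once c is moved under u, the difference ((ab)d)c - (a(bd))c is resolved by the pentagon: both
    terms lead to a(b(dc)). *)
Lemma O2_star nn p mm y c : O2gen A T nn p y -> O nn mm (star nn p mm y c).
Proof.
move=> [a [b [d [u [p1 [p2 [p3 ->]]]]]]].
apply: vspan_subr (star_assoc _ _ _ _ _ _ _) _; rewrite starBl starBr.
have h1 := star_assoc_left nn mm p p1 p3 u (star p3 p2 p1 a b) d c.
have h2 := star_assoc_left nn mm p1 p2 p3 u a b (star p1 p mm d c).
have h3 := star_assoc_left nn mm p p2 p3 u a (star p2 p1 p b d) c.
(* The pentagon edge that lies under both u and a: reassociate to the single left factor u a, apply
   the generator, and go back. *)
have h4 : O nn mm (star nn p3 mm u (star p3 p2 mm a (star p2 p mm (star p2 p1 p b d) c))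
     - star nn p3 mm u (star p3 p2 mm a (star p2 p1 mm b (star p1 p mm d c)))).
  have e x := star_assoc nn mm p2 p3 u a x.
  have := star_assoc_left nn mm p p1 p2 (star nn p3 p2 u a) b d c.
  move/(vspan_trans)=> /(_ _ (e _)) h.
  have := vspanN (e (star p2 p mm (star p2 p1 p b d) c)); rewrite opprB.
  by move/vspan_trans; apply.
have h12 := vspan_trans h1 h2; have h34 := vspan_trans h3 h4.
by have := vspanB h12 h34; rewrite opprB addrA subrK.
Qed.

Lemma O3_star nn p mm y c :
  (O0gen A T nn p y \/ O1gen A T nn p y) -> O nn mm (star nn p mm y c).
Proof.
move=> hy; apply: mem_vspan; right; right; right.
exists vac, c, y, p, nn; split; first exact: mem_vspan.
by rewrite star_vac_left.
Qed.

(** Generators of O_0 and O_1 become O_3 generators with u = 1, O_2 is the pentagon, and for O_3 the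
    factor c joins the last one: ((u y')d)c = (u y')(dc) modulo O. *)
Lemma O_star nn p mm y c : O nn p y -> O nn mm (star nn p mm y c).
Proof.
elim/vspan_ind: y / => [|k x y hx hy|y]; first by rewrite star0l; apply: vspan0.
  by rewrite star_linl; apply: vspanZD.
case=> [h|[h|[h|[u [d [y' [p1 [p2 [hy' ->]]]]]]]]].
- by apply: O3_star; left.
- by apply: O3_star; right.
- exact: O2_star.
apply: vspan_subr (star_assoc _ _ _ _ _ _ _) _.
apply: mem_vspan; right; right; right.
by exists u, (star p1 p mm d c), y', p1, p2.
Qed.

Lemma star_O nn p mm u y : O p mm y -> O nn mm (star nn p mm u y).
Proof.
elim/vspan_ind: y / => [|k x y hx hy|y]; first by rewrite star0r; apply: vspan0.
  by rewrite star_linr; apply: vspanZD.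
have h01 y' : O0gen A T p mm y' \/ O1gen A T p mm y' -> O nn mm (star nn p mm u y').
  (* By the right unit law u y' is congruent to (u y')1, an O_3 generator. *)
  move=> h; rewrite -[star _ _ _ _ _](subKr (star nn mm mm (star nn p mm u y') vac)).
  apply: vspanB; last exact: star_vac_right.
  apply: mem_vspan; right; right; right.
  by exists u, vac, y', mm, p; split=> //; apply: mem_vspan.
case=> [h|[h|[[a [b [c [u' [p1 [p2 [p3 ->]]]]]]]|[u' [d [y' [p1 [p2 [hy' ->]]]]]]]]].
- by apply: h01; left.
- by apply: h01; right.
- set X := _ - _; have := vspanN (star_assoc nn mm p3 p u u' X).
  rewrite opprB => h.
  apply: vspan_subr h _.
  apply: mem_vspan; right; right; left.
  by exists a, b, c, (star nn p p3 u u'), p1, p2, p3.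
have := vspanN (star_assoc nn mm p1 p u (star p p2 p1 u' y') d); rewrite opprB => h.
apply: vspan_subr h _.
(* Reassociation takes place inside the left factor: (u(u' y'))d becomes ((u u')y')d, and right
   stability keeps the error in O. *)
have := O_star mm d (vspanN (star_assoc nn p1 p2 p u u' y')); rewrite ?opprB starBl.
set Y := star nn p1 mm (star nn p2 p1 _ _) d => h.
apply: vspan_subr h _.
by apply: mem_vspan; right; right; right; exists (star nn p p2 u u'), d, y', p1, p2.
Qed.

Lemma star_congr nn p mm a a' b b' : O nn p (a - a') -> O p mm (b - b') ->
  O nn mm (star nn p mm a b - star nn p mm a' b').
Proof.
move=> /(O_star mm b); rewrite starBl => ha /(star_O nn a'); rewrite starBr.
exact: vspan_trans.
Qed.

Lemma star_bimodule nn mm : induces_bimodule A T nn mm.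
Proof.
do ![split] => *; try exact: star_congr; try exact: star_assoc;
  try exact: star_vac_right.
- by rewrite star_linl subrr; apply: vspan0.
- by rewrite star_linr subrr; apply: vspan0.
- by rewrite star_linl subrr; apply: vspan0.
- by rewrite star_linr subrr; apply: vspan0.
- by rewrite star_vac_left subrr; apply: vspan0.
Qed.

End Products.

(* n = nn/T, m = mm/T in (1/T)N; K is any field of characteristic 0
   (the paper's C) *)
Theorem mainTheorem10 (K : fieldType) (V : lmodType K) (A : VA V) (T : nat)
    (nn mm : nat) :
  [pchar K] =i pred0 -> (0 < T)%N ->
  induces_assoc_algebra A T mm /\ induces_bimodule A T nn mm.
Proof.
move=> charK T0; split; last exact: star_bimodule.
(* For n = m the bimodule clauses contain the algebra clauses. *)
have [h1 [_ [h2 [h3 [_ [_ [h4 [_ [_ h5]]]]]]]]] := star_bimodule charK A T0 mm mm.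
by split.
Qed.
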